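(* Fix $\varepsilon\in(0,1]$ and set $B:=\varepsilon^{-1}\int_0^\varepsilon A_\alpha\,d\alpha\in\mathbb{P}(\mathbb{Z}^+)$ (i.e. $B(k)=\varepsilon^{-1}\int_0^\varepsilon A_\alpha(k)\,d\alpha$). For $\beta\in(0,1)$ put $B_\beta:=\sum_{k\ge0}A_\beta(k)B^{(k)}$. Then $B_\beta\in\mathcal{A}$, and for each $\alpha\in(0,1)$, $$\lim_{\xi\to0}\frac{|\xi|^{\alpha}}{|1-\widehat{B_\beta}(\xi)|}=0.$$
   Context: For $\alpha\in(0,1)$, $A_\alpha\in\mathbb{P}(\mathbb{Z}^+)$ is given by $A_\alpha(0)=0$, $A_\alpha(k)=\alpha(1-\alpha)\cdots((k-1)-\alpha)/k!$ for $k\in\mathbb{N}$. $\mathbb{P}(\mathbb{Z}^+)$ is the set of functions $F:\mathbb{Z}\to[0,1]$ with $\sum F=1$ and $F(k)=0$ for $k<0$. $B^{(k)}$ is the $k$-th convolution power, $B^{(0)}=\delta_0$. $\widehat{F}(\xi)=\sum_kF(k)e^{-ik\xi}$. $\mathcal{A}=\{F\in\mathbb{P}(\mathbb{Z}^+):\sup_{n\in\mathbb{N}}n\sum_k|F^{(n)}(k)-F^{(n+1)}(k)|<\infty\}$. *)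

(* Defs.v *)
From Stdlib Require Import Reals Factorial.
From Coquelicot Require Import Coquelicot.
Open Scope R_scope.

(* Elements of P(Z^+) are represented by their restriction F : nat -> R
   (F(k) = 0 for k < 0 is implicit). *)

Definition Aalpha (alpha : R) (k : nat) : R :=
  match k with
  | O => 0
  | S m => alpha * (fix p (j : nat) : R :=
                      match j with O => 1 | S j' => p j' * (INR (S j') - alpha) end) m
           / INR (fact k)
  end.

Definition conv (F G : nat -> R) (n : nat) : R :=
  sum_f_R0 (fun i => F i * G (n - i)%nat) n.

Definition delta0 (n : nat) : R := match n with O => 1 | _ => 0 end.

Fixpoint cpow (F : nat -> R) (k : nat) : nat -> R :=
  match k with
  | O => delta0
  | S k' => conv F (cpow F k')
  end.

Definition isProb (F : nat -> R) : Prop :=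
  (forall k, 0 <= F k <= 1) /\ is_series F 1.

Definition inA (F : nat -> R) : Prop :=
  isProb F /\
  exists M : R, forall n : nat, (1 <= n)%nat ->
    ex_series (fun k => Rabs (cpow F n k - cpow F (S n) k)) /\
    INR n * Series (fun k => Rabs (cpow F n k - cpow F (S n) k)) <= M.

Definition fourier (F : nat -> R) (xi : R) : C :=
  (Series (fun k => F k * cos (INR k * xi)),
   - Series (fun k => F k * sin (INR k * xi))).

Definition Beps (eps : R) (k : nat) : R :=
  / eps * RInt (fun a => Aalpha a k) 0 eps.

Definition Bbeta (eps beta : R) (j : nat) : R :=
  Series (fun k => Aalpha beta k * cpow (Beps eps) k j).

(* Main.v *)
(* Write [f_n] for the n-th convolution power of the Sibuya law [Aalpha b].  Its
   generating function [w = 1 - (1-z)^b] satisfies [(1-z) w' = b (1-w)], hence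
     [(k+1) f_(n+1)(k+1) - k f_(n+1)(k) = (n+1) b (f_n(k) - f_(n+1)(k))].
   Summing over [k], the partial sums of [f_n - f_(n+1)] are
   [(k+1) f_(n+1)(k+1) / ((n+1) b)], and the recurrence read as a convex combination
   bounds them by [1 / ((n+1) b (1-b))].  The recurrence also propagates unimodality of
   [n |-> f_n(k)], which makes [k |-> f_n(k) - f_(n+1)(k)] change sign only once; so its
   l^1 norm is at most twice the largest partial sum, i.e. O(1/n).  Subordination
   [X |-> sum_k X(k) B^(k)] is multiplicative for convolution and contracts l^1, which
   transfers the bound to [Bbeta].  For the limit, [Bbeta >= beta Beps] pointwise and
   [Beps(k) >= c k^(-1-d)] for every small [d > 0], so
   [Re (1 - fourier Bbeta xi) >= K |xi|^d]. *)
Require Import Defs.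
From Stdlib Require Import Reals Factorial Lra Lia FunctionalExtensionality.
From Coquelicot Require Import Coquelicot.
Open Scope R_scope.

(** * Finite sums: truncation and exchange of order *)

Lemma sum_f_R0_zero (a : nat -> R) (N : nat) :
  (forall i, (i <= N)%nat -> a i = 0) -> sum_f_R0 a N = 0.
Proof.
  induction N as [|N IH]; intros H; simpl.
  - apply H; lia.
  - rewrite IH, H; [ring | lia | intros; apply H; lia].
Qed.

Lemma sum_f_R0_extend (a : nat -> R) (N M : nat) :
  (N <= M)%nat -> (forall i, (N < i)%nat -> a i = 0) ->
  sum_f_R0 a M = sum_f_R0 a N.
Proof.
  intros HM H. induction HM as [|M HM IH]; [reflexivity|].
  simpl. rewrite IH, H; [ring | lia].
Qed.

Lemma sum_f_R0_incr (a : nat -> R) (N M : nat) :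
  (forall i, 0 <= a i) -> (N <= M)%nat -> sum_f_R0 a N <= sum_f_R0 a M.
Proof.
  intros H HM. induction HM as [|M HM IH]; simpl; [lra|].
  specialize (H (S M)); lra.
Qed.

Lemma sum_f_R0_swap (G : nat -> nat -> R) (N M : nat) :
  sum_f_R0 (fun i => sum_f_R0 (G i) M) N =
  sum_f_R0 (fun j => sum_f_R0 (fun i => G i j) N) M.
Proof.
  induction N as [|N IH]; simpl; [reflexivity|].
  rewrite IH, <- plus_sum. reflexivity.
Qed.

(** Both sides sum [G i l] over [i + l <= N], once by antidiagonals and once by rows. *)
Lemma sum_f_R0_triangle_swap (G : nat -> nat -> R) (N : nat) :
  sum_f_R0 (fun m => sum_f_R0 (fun i => G i (m - i)%nat) m) N =
  sum_f_R0 (fun i => sum_f_R0 (G i) (N - i)) N.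
Proof.
  induction N as [|N IH]; [reflexivity|].
  rewrite (tech5 _ N), IH, (tech5 (fun i => sum_f_R0 (G i) (S N - i))).
  cbv beta. rewrite (tech5 (fun i => G i (S N - i)%nat)), Nat.sub_diag.
  rewrite (sum_eq (fun i => sum_f_R0 (G i) (S N - i))
             (fun i => sum_f_R0 (G i) (N - i) + G i (S N - i)%nat) N).
  - rewrite plus_sum. simpl. ring.
  - intros i Hi. rewrite Nat.sub_succ_l by lia. reflexivity.
Qed.

(** * Convolution and its powers *)

Lemma conv_assoc (F G H : nat -> R) : conv F (conv G H) = conv (conv F G) H.
Proof.
  apply functional_extensionality; intros n. unfold conv.
  rewrite (sum_eq (fun i => sum_f_R0 (fun j => F j * G (i - j)%nat) i * H (n - i)%nat)
    (fun m => sum_f_R0 (fun i => (fun i l => F i * (G l * H (n - i - l)%nat)) i (m - i)%nat) m) n).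
  - rewrite (sum_f_R0_triangle_swap (fun i l => F i * (G l * H (n - i - l)%nat))).
    apply sum_eq; intros i Hi. rewrite scal_sum. apply sum_eq; intros; ring.
  - intros m Hm. rewrite Rmult_comm, scal_sum. apply sum_eq; intros i Hi.
    replace (n - i - (m - i))%nat with (n - m)%nat by lia. ring.
Qed.

Lemma conv_delta0 (F : nat -> R) : conv delta0 F = F.
Proof.
  apply functional_extensionality; intros n. unfold conv.
  rewrite (sum_f_R0_extend _ 0 n); [simpl; rewrite Nat.sub_0_r; ring | lia |].
  intros [|i] Hi; [lia|]; simpl; ring.
Qed.

Lemma cpow_1 (F : nat -> R) : cpow F 1 = F.
Proof.
  apply functional_extensionality; intros j. simpl. unfold conv.
  destruct j as [|j]; [simpl; ring|].
  rewrite tech5, Nat.sub_diag, sum_f_R0_zero; [simpl; ring|].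
  intros i Hi. rewrite Nat.sub_succ_l by lia. simpl. ring.
Qed.

Lemma cpow_add (F : nat -> R) (k l : nat) :
  cpow F (k + l) = conv (cpow F k) (cpow F l).
Proof.
  induction k as [|k IH]; simpl.
  - now rewrite conv_delta0.
  - now rewrite IH, conv_assoc.
Qed.

Lemma conv_nonneg (F G : nat -> R) :
  (forall k, 0 <= F k) -> (forall k, 0 <= G k) -> forall k, 0 <= conv F G k.
Proof.
  intros HF HG k. apply cond_pos_sum; intros i. now apply Rmult_le_pos.
Qed.

Lemma cpow_nonneg (F : nat -> R) (n : nat) :
  (forall k, 0 <= F k) -> forall k, 0 <= cpow F n k.
Proof.
  intros HF. induction n as [|n IH]; simpl.
  - intros [|k]; simpl; lra.
  - now apply conv_nonneg.
Qed.

Lemma cpow_lt (F : nat -> R) (n k : nat) : F O = 0 -> (k < n)%nat -> cpow F n k = 0.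
Proof.
  intros HF. revert k. induction n as [|n IH]; intros k Hk; [lia|].
  simpl. apply sum_f_R0_zero; intros [|i] Hi.
  - rewrite HF; ring.
  - rewrite IH by lia. ring.
Qed.

Lemma conv_prob (F G : nat -> R) :
  (forall k, 0 <= F k) -> (forall k, 0 <= G k) ->
  is_series F 1 -> is_series G 1 -> is_series (conv F G) 1.
Proof.
  intros HF HG SF SG. replace 1 with (1 * 1) by ring.
  apply is_series_mult_pos; assumption.
Qed.

Lemma is_series_delta0 : is_series delta0 1.
Proof.
  apply is_series_Reals. intros e He. exists O. intros n _.
  rewrite (sum_f_R0_extend _ 0 n); [| lia | intros [|i] Hi; [lia | reflexivity]].
  simpl. rewrite R_dist_eq. exact He.
Qed.

Lemma cpow_prob (F : nat -> R) (n : nat) :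
  (forall k, 0 <= F k) -> is_series F 1 -> is_series (cpow F n) 1.
Proof.
  intros HF SF. induction n as [|n IH]; simpl.
  - exact is_series_delta0.
  - apply conv_prob; auto. now apply cpow_nonneg.
Qed.

(** * Series controlled through their partial sums *)

Lemma nonneg_bounded_series (a : nat -> R) (M : R) :
  (forall k, 0 <= a k) -> (forall N, sum_f_R0 a N <= M) ->
  ex_series a /\ Series a <= M.
Proof.
  intros Ha HM.
  assert (Hex : ex_finite_lim_seq (sum_n a)).
  { apply ex_finite_lim_seq_incr with M.
    - intros n. rewrite sum_Sn. unfold plus; simpl. specialize (Ha (S n)); lra.
    - intros n. rewrite sum_n_Reals. apply HM. }
  assert (Hs : ex_series a) by exact Hex.
  split; [exact Hs|].
  apply (is_lim_seq_le (sum_n a) (fun _ => M) (Series a) M).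
  - intros n. rewrite sum_n_Reals. apply HM.
  - apply Series_correct, Hs.
  - apply is_lim_seq_const.
Qed.

Lemma nonneg_series_partial (a : nat -> R) (l : R) (N : nat) :
  (forall k, 0 <= a k) -> is_series a l -> sum_f_R0 a N <= l.
Proof.
  intros Ha Hl.
  apply (is_lim_seq_le_loc (fun _ => sum_f_R0 a N) (sum_n a) (sum_f_R0 a N) l).
  - exists N. intros n Hn. rewrite sum_n_Reals. now apply sum_f_R0_incr.
  - apply is_lim_seq_const.
  - exact Hl.
Qed.

Lemma is_series_sandwich (a b : nat -> R) (l : R) :
  (forall N, l - b N <= sum_f_R0 a N <= l) -> is_lim_seq b 0 -> is_series a l.
Proof.
  intros H Hb.
  change (is_lim_seq (sum_n a) l).
  apply is_lim_seq_le_le with (u := fun N => l - b N) (w := fun _ => l).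
  - intros n. rewrite sum_n_Reals. apply H.
  - replace (Finite l) with (Rbar_minus l 0) by (simpl; f_equal; ring).
    apply is_lim_seq_minus with (l1 := l) (l2 := 0);
      [apply is_lim_seq_const | exact Hb | reflexivity].
  - apply is_lim_seq_const.
Qed.

(** * The Sibuya law *)

(* [prod_(1 <= j <= m) (1 - a/j)], the tail mass beyond [m] of [Aalpha a]. *)
Definition sibuya_tail (a : R) (m : nat) : R :=
  (fix p (j : nat) : R := match j with O => 1 | S j' => p j' * (INR (S j') - a) end) m
  / INR (fact m).

Lemma sibuya_tail_S (a : R) (m : nat) :
  sibuya_tail a (S m) = sibuya_tail a m * (1 - a / INR (S m)).
Proof.
  unfold sibuya_tail. rewrite fact_simpl, mult_INR.
  field. split; first [apply INR_fact_neq_0 | apply not_0_INR; lia].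
Qed.

Lemma Aalpha_S (a : R) (m : nat) : Aalpha a (S m) = a * sibuya_tail a m / INR (S m).
Proof.
  unfold sibuya_tail, Aalpha. rewrite fact_simpl, mult_INR.
  field. split; first [apply INR_fact_neq_0 | apply not_0_INR; lia].
Qed.

Lemma sibuya_tail_pos_factor (a : R) (m : nat) : 0 <= a <= 1 -> 0 <= 1 - a / INR (S m).
Proof.
  intros Ha.
  assert (H : 1 <= INR (S m)) by (rewrite S_INR; pose proof (pos_INR m); lra).
  assert (a / INR (S m) <= 1) by (apply Rle_div_l; lra). lra.
Qed.

Lemma sibuya_tail_nonneg (a : R) (m : nat) : 0 <= a <= 1 -> 0 <= sibuya_tail a m.
Proof.
  intros Ha. induction m as [|m IH].
  - unfold sibuya_tail; simpl; lra.
  - rewrite sibuya_tail_S. apply Rmult_le_pos; [exact IH | now apply sibuya_tail_pos_factor].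
Qed.

Lemma Aalpha_nonneg (a : R) (k : nat) : 0 <= a <= 1 -> 0 <= Aalpha a k.
Proof.
  intros Ha. destruct k as [|m]; [simpl; lra|].
  rewrite Aalpha_S. apply Rmult_le_pos.
  - apply Rmult_le_pos; [lra | now apply sibuya_tail_nonneg].
  - left; apply Rinv_0_lt_compat, lt_0_INR; lia.
Qed.

(** Telescoping: [Aalpha a (S N)] equals [sibuya_tail a N - sibuya_tail a (S N)]. *)
Lemma sum_Aalpha (a : R) (N : nat) : sum_f_R0 (Aalpha a) N = 1 - sibuya_tail a N.
Proof.
  induction N as [|N IH].
  - unfold sibuya_tail; simpl; field.
  - rewrite tech5, IH, sibuya_tail_S, Aalpha_S. field. apply not_0_INR; lia.
Qed.

Lemma ln_succ_le (m : nat) : ln (INR (S (S m))) - ln (INR (S m)) <= / INR (S m).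
Proof.
  assert (H : 0 < INR (S m)) by (apply lt_0_INR; lia).
  rewrite <- ln_div by (try apply lt_0_INR; try lia; lra).
  rewrite (S_INR (S m)).
  replace ((INR (S m) + 1) / INR (S m)) with (1 + / INR (S m)) by (field; lra).
  pose proof (Rinv_0_lt_compat _ H).
  rewrite <- (ln_exp (/ INR (S m))) at 2. apply ln_le; [lra | apply exp_ineq1_le].
Qed.

Lemma exp_monotone (x y : R) : x <= y -> exp x <= exp y.
Proof.
  intros [H | ->]; [left; now apply exp_increasing | lra].
Qed.

(** Each factor satisfies [1 - a/j <= exp (-a/j)], and harmonic sums dominate the logarithm. The
    bound is [(m+1)^(-a)]. *)
Lemma sibuya_tail_le (a : R) (m : nat) : 0 <= a <= 1 ->
  sibuya_tail a m <= exp (- (a * ln (INR (S m)))).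
Proof.
  intros Ha. induction m as [|m IH].
  - unfold sibuya_tail; simpl. rewrite ln_1, Rmult_0_r, Ropp_0, exp_0. lra.
  - rewrite sibuya_tail_S.
    apply Rle_trans with (exp (- (a * ln (INR (S m)))) * exp (- (a / INR (S m)))).
    + apply Rmult_le_compat; [now apply sibuya_tail_nonneg | now apply sibuya_tail_pos_factor | exact IH |].
      pose proof (exp_ineq1_le (- (a / INR (S m)))); lra.
    + rewrite <- exp_plus. apply exp_monotone.
      pose proof (ln_succ_le m). unfold Rdiv. nra.
Qed.

(** Convexity of [exp]: the tangent at [a * L] lies below the graph at [L] and at 0, and these two
    inequalities are averaged with weights [a] and [1 - a]. *)
Lemma exp_convex_mul (a L : R) : 0 <= a <= 1 -> exp (a * L) <= 1 - a + a * exp L.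
Proof.
  intros Ha.
  pose proof (exp_ineq1_le (L - a * L)) as H1.
  pose proof (exp_ineq1_le (- (a * L))) as H2.
  pose proof (exp_pos (a * L)) as H3.
  assert (E1 : exp L = exp (L - a * L) * exp (a * L)) by (rewrite <- exp_plus; f_equal; ring).
  assert (E2 : exp (- (a * L)) * exp (a * L) = 1)
    by (rewrite <- exp_plus, Rplus_opp_l; apply exp_0).
  rewrite E1.
  assert (K : 1 <= a * exp (L - a * L) + (1 - a) * exp (- (a * L))) by nra.
  nra.
Qed.

(** The first factor [1 - a] is kept as the constant. A later factor
    [1 - a/(m+2) = 1 - a + a (m+1)/(m+2)] is at least [((m+1)/(m+2))^a] by convexity, and these
    powers telescope. *)
Lemma sibuya_tail_ge (a : R) (m : nat) : 0 <= a <= 1 ->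
  (1 - a) * exp (- (a * ln (INR (S m)))) <= sibuya_tail a (S m).
Proof.
  intros Ha. induction m as [|m IH].
  - rewrite sibuya_tail_S. unfold sibuya_tail; simpl. rewrite ln_1, Rmult_0_r, Ropp_0, exp_0. lra.
  - rewrite sibuya_tail_S.
    set (L := ln (INR (S m)) - ln (INR (S (S m)))).
    replace (- (a * ln (INR (S (S m))))) with (- (a * ln (INR (S m))) + a * L)
      by (unfold L; ring).
    rewrite exp_plus, <- Rmult_assoc.
    assert (0 < INR (S m)) by (apply lt_0_INR; lia).
    assert (EL : exp L = INR (S m) / INR (S (S m))).
    { unfold L. rewrite <- ln_div by (try apply lt_0_INR; try lia; lra).
      apply exp_ln. apply Rdiv_lt_0_compat; [lra | apply lt_0_INR; lia]. }
    apply Rmult_le_compat; [| left; apply exp_pos | exact IH |].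
    + apply Rmult_le_pos; [lra | left; apply exp_pos].
    + pose proof (exp_convex_mul a L Ha) as HH. rewrite EL in HH.
      rewrite (S_INR (S m)) in *.
      replace (1 - a / (INR (S m) + 1)) with (1 - a + a * (INR (S m) / (INR (S m) + 1)))
        by (field; lra). exact HH.
Qed.

Lemma lim_ln_S : is_lim_seq (fun n => ln (INR (S n))) p_infty.
Proof.
  apply (is_lim_seq_incr_1 (fun n => ln (INR n))).
  apply (is_lim_comp_seq ln INR p_infty p_infty).
  - apply is_lim_ln_p.
  - exists O; intros; discriminate.
  - apply is_lim_seq_INR.
Qed.

Lemma Aalpha_prob (a : R) : 0 < a < 1 -> is_series (Aalpha a) 1.
Proof.
  intros Ha.
  apply is_series_sandwich with (b := fun N => exp (- (a * ln (INR (S N))))).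
  - intros N. rewrite sum_Aalpha.
    pose proof (sibuya_tail_le a N); pose proof (sibuya_tail_nonneg a N). split; lra.
  - apply (is_lim_comp_seq exp _ m_infty 0).
    + apply is_lim_exp_m.
    + exists O; intros; discriminate.
    + replace m_infty with (Rbar_opp p_infty) by reflexivity.
      apply -> is_lim_seq_opp.
      replace p_infty with (Rbar_mult a p_infty).
      * apply is_lim_seq_scal_l, lim_ln_S.
      * simpl. destruct (Rle_dec 0 a) as [H|H]; [|lra].
        destruct (Rle_lt_or_eq_dec 0 a H); [reflexivity | lra].
Qed.

(** * The differential equation in coefficient form *)

(* The operator [(1 - z) d/dz] on coefficient sequences. *)
Definition euler (x : nat -> R) (k : nat) : R := INR (S k) * x (S k) - INR k * x k.

(** The Leibniz rule for the derivation [(1 - z) d/dz]. *)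
Lemma euler_conv (x y : nat -> R) (k : nat) :
  euler (conv x y) k = conv (euler x) y k + conv x (euler y) k.
Proof.
  (* Leibniz rule for [z d/dz], from [n = i + (n - i)]. *)
  assert (E : forall n, INR n * conv x y n =
    sum_f_R0 (fun i => INR i * x i * y (n - i)%nat) n +
    sum_f_R0 (fun i => x i * (INR (n - i) * y (n - i)%nat)) n).
  { intros n. unfold conv. rewrite <- plus_sum, scal_sum.
    apply sum_eq; intros i Hi. rewrite minus_INR by lia. ring. }
  unfold euler at 1. rewrite !E.
  (* The end terms split off here carry a factor [INR 0]; what remains are sums up to [k]. *)
  rewrite (decomp_sum (fun i => INR i * x i * y (S k - i)%nat)) by lia.
  rewrite (tech5 (fun i => x i * (INR (S k - i) * y (S k - i)%nat))), Nat.sub_diag.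
  simpl pred. unfold conv.
  rewrite (sum_eq (fun i => x i * (INR (S k - i) * y (S k - i)%nat))
            (fun i => x i * euler y (k - i) + x i * (INR (k - i) * y (k - i)%nat)) k).
  2:{ intros i Hi. rewrite Nat.sub_succ_l by lia. unfold euler. ring. }
  rewrite (sum_eq (fun i => INR (S i) * x (S i) * y (S k - S i)%nat)
            (fun i => euler x i * y (k - i)%nat + INR i * x i * y (k - i)%nat) k).
  2:{ intros i Hi. unfold euler. simpl (S k - S i)%nat. ring. }
  rewrite !plus_sum. simpl (INR 0). ring.
Qed.

Lemma euler_Aalpha (b : R) (k : nat) : euler (Aalpha b) k = b * (delta0 k - Aalpha b k).
Proof.
  unfold euler. destruct k as [|k].
  - simpl. field.
  - rewrite !Aalpha_S, sibuya_tail_S. simpl delta0. field. split; apply not_0_INR; lia.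
Qed.

Lemma conv_lin (x y z : nat -> R) (c : R) (k : nat) :
  conv x (fun i => c * (y i - z i)) k = c * (conv x y k - conv x z k).
Proof.
  unfold conv. rewrite Rmult_minus_distr_l, !scal_sum, <- minus_sum.
  apply sum_eq; intros; ring.
Qed.

Lemma conv_lin_l (x y z : nat -> R) (c : R) (k : nat) :
  conv (fun i => c * (y i - z i)) x k = c * (conv y x k - conv z x k).
Proof.
  unfold conv. rewrite Rmult_minus_distr_l, !scal_sum, <- minus_sum.
  apply sum_eq; intros; ring.
Qed.

(** Coefficients of [(1-z) (w^(n+1))' = (n+1) w^n (1-z) w' = (n+1) b (w^n - w^(n+1))]. *)
Lemma euler_cpow (b : R) (n k : nat) :
  euler (cpow (Aalpha b) (S n)) k =
  INR (S n) * b * (cpow (Aalpha b) n k - cpow (Aalpha b) (S n) k).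
Proof.
  assert (EA : euler (Aalpha b) = fun i => b * (delta0 i - Aalpha b i))
    by (apply functional_extensionality; intros; apply euler_Aalpha).
  revert k. induction n as [|n IH]; intros k.
  - rewrite cpow_1, EA. simpl. ring.
  - change (cpow (Aalpha b) (S (S n))) with (conv (Aalpha b) (cpow (Aalpha b) (S n))) at 1.
    rewrite euler_conv, EA, conv_lin_l, conv_delta0.
    rewrite (functional_extensionality _ _ IH).
    rewrite conv_lin.
    change (conv (Aalpha b) (cpow (Aalpha b) n)) with (cpow (Aalpha b) (S n)).
    change (conv (Aalpha b) (cpow (Aalpha b) (S n))) with (cpow (Aalpha b) (S (S n))).
    rewrite (S_INR (S n)). ring.
Qed.

(** * Differences of consecutive powers *)

Definition stepdiff (b : R) (n k : nat) : R :=
  cpow (Aalpha b) n k - cpow (Aalpha b) (S n) k.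

Lemma cpow_Aalpha_rec (b : R) (n k : nat) :
  INR (S k) * cpow (Aalpha b) (S n) (S k) =
  INR k * cpow (Aalpha b) (S n) k + INR (S n) * b * stepdiff b n k.
Proof.
  pose proof (euler_cpow b n k) as H. unfold euler in H. unfold stepdiff. lra.
Qed.

(** Difference of the recurrences for two consecutive powers. For [0 < b < 1] and [n + 2 <= k] both
    coefficients on the right are nonnegative, so signs pass from column [k] to column [k + 1]. *)
Lemma stepdiff_rec (b : R) (n k : nat) :
  INR (S k) * stepdiff b (S n) (S k) =
  (INR k - INR (S (S n)) * b) * stepdiff b (S n) k + INR (S n) * b * stepdiff b n k.
Proof.
  pose proof (cpow_Aalpha_rec b n k) as H1.
  pose proof (cpow_Aalpha_rec b (S n) k) as H2.
  unfold stepdiff at 1. rewrite Rmult_minus_distr_l, H1, H2.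
  unfold stepdiff. ring.
Qed.

Lemma sum_stepdiff (b : R) (n K : nat) :
  INR (S n) * b * sum_f_R0 (stepdiff b n) K = INR (S K) * cpow (Aalpha b) (S n) (S K).
Proof.
  induction K as [|K IH].
  - rewrite cpow_Aalpha_rec. simpl. ring.
  - rewrite tech5, Rmult_plus_distr_l, IH, (cpow_Aalpha_rec b n (S K)). reflexivity.
Qed.

Lemma cpow_Aalpha_diag (b : R) (n : nat) : cpow (Aalpha b) n n = b ^ n.
Proof.
  induction n as [|n IH]; [reflexivity|].
  apply (Rmult_eq_reg_l (INR (S n))); [|apply not_0_INR; lia].
  rewrite cpow_Aalpha_rec. unfold stepdiff.
  rewrite (cpow_lt _ (S n) n), IH by (reflexivity || lia). simpl pow. ring.
Qed.

(** Since [w = b z + b (1-b)/2 z^2 + ...], this is the second coefficient of [w^n]. It settles the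
    corner case of unimodality. *)
Lemma cpow_Aalpha_subdiag (b : R) (n : nat) :
  cpow (Aalpha b) n (S n) = INR n * b ^ n * (1 - b) / 2.
Proof.
  induction n as [|n IH]; [simpl; field|].
  apply (Rmult_eq_reg_l (INR (S (S n)))); [|apply not_0_INR; lia].
  rewrite cpow_Aalpha_rec. unfold stepdiff.
  rewrite cpow_Aalpha_diag, IH. rewrite !S_INR. simpl pow. field.
Qed.

(** [1 - b^k] is [1 - b] times a geometric sum of [k] terms, each at least [b^k]. *)
Lemma INR_mul_pow_le (b : R) (k : nat) : 0 < b < 1 -> INR k * b ^ k * (1 - b) <= 1 - b ^ k.
Proof.
  intros Hb. induction k as [|k IH]; [simpl; lra|].
  rewrite S_INR. simpl pow.
  assert (H : 0 <= b ^ k <= 1).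
  { split; [apply pow_le; lra|]. rewrite <- (pow1 k). apply pow_incr; lra. }
  pose proof (Rmult_le_compat_l b _ _ ltac:(lra) IH) as IH'.
  assert (0 <= (1 - b) * (1 - b * b ^ k)) by (apply Rmult_le_pos; nra).
  nra.
Qed.

(* For [n <= k] the recurrence writes [(k+1) f_n(k+1)] as a convex combination
   of [k f_n(k)] and [k f_(n-1)(k)]. *)
Lemma cpow_Aalpha_bound (b : R) (n k : nat) : 0 < b < 1 ->
  INR k * cpow (Aalpha b) n k <= / (1 - b).
Proof.
  intros Hb. revert n. induction k as [|k IH]; intros n.
  - simpl. rewrite Rmult_0_l. left; apply Rinv_0_lt_compat; lra.
  - assert (P : 0 < / (1 - b)) by (apply Rinv_0_lt_compat; lra).
    destruct n as [|n]; [simpl cpow; simpl delta0; lra|].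
    destruct (Nat.lt_trichotomy (S n) (S k)) as [H|[H|H]].
    + rewrite cpow_Aalpha_rec. unfold stepdiff.
      pose proof (IH n) as H1. pose proof (IH (S n)) as H2.
      assert (Hk : 0 < INR k) by (apply lt_0_INR; lia).
      (* The weight of row [n]; it is at most 1 because [n + 1 <= k] and [b < 1]. *)
      set (t := INR (S n) * b / INR k).
      assert (Ht : 0 <= t <= 1).
      { assert (INR (S n) <= INR k) by (apply le_INR; lia).
        pose proof (pos_INR (S n)).
        split; unfold t; [apply Rdiv_le_0_compat; nra | apply Rle_div_l; nra]. }
      replace (INR k * cpow (Aalpha b) (S n) k +
         INR (S n) * b * (cpow (Aalpha b) n k - cpow (Aalpha b) (S n) k))
        with ((1 - t) * (INR k * cpow (Aalpha b) (S n) k) + t * (INR k * cpow (Aalpha b) n k))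
        by (unfold t; field; lra).
      nra.
    (* On the diagonal that weight could exceed 1, so the exact value [b^(k+1)] is used. *)
    + injection H as ->. rewrite cpow_Aalpha_diag.
      apply (Rmult_le_reg_r (1 - b)); [lra|].
      rewrite Rinv_l by lra.
      pose proof (INR_mul_pow_le b (S k) Hb). assert (0 <= b ^ S k) by (apply pow_le; lra). lra.
    + rewrite cpow_lt by (reflexivity || lia). lra.
Qed.

Lemma stepdiff_0_neg (b : R) (k : nat) : 0 < b < 1 -> stepdiff b 0 (S k) <= 0.
Proof.
  intros Hb. unfold stepdiff. simpl cpow at 1. simpl delta0.
  pose proof (cpow_nonneg (Aalpha b) 1 (fun k => Aalpha_nonneg b k ltac:(lra)) (S k)). lra.
Qed.

(** In column [k], a rise from [n + 1] to [n + 2] is preceded by a rise from [n] to [n + 1].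
    Induction on the column: the sign at [k + 1] follows from signs at [k] through
    [stepdiff_rec]. *)
Lemma stepdiff_unimodal (b : R) (k n : nat) : 0 < b < 1 ->
  (S (S n) <= k)%nat -> stepdiff b (S n) k <= 0 -> stepdiff b n k <= 0.
Proof.
  intros Hb. revert n. induction k as [|k IH]; intros n Hn Hd; [lia|].
  destruct n as [|p]; [now apply stepdiff_0_neg|].
  assert (Key : stepdiff b (S p) k <= 0).
  { destruct (Nat.eq_dec (S (S p)) k) as [E|E].
    (* Corner case, by explicit values: the hypothesis says [(N + 1) (1 - b) / 2 <= b], the goal
       only needs [N (1 - b) / 2 <= b]. *)
    - subst k. revert Hd. unfold stepdiff.
      rewrite !cpow_Aalpha_subdiag, !cpow_Aalpha_diag.
      assert (0 < b ^ S p) by (apply pow_lt; lra).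
      rewrite (S_INR (S p)), (eq_refl : b ^ S (S (S p)) = b * b ^ S (S p)),
        (eq_refl : b ^ S (S p) = b * b ^ S p).
      set (x := b ^ S p) in *. set (N := INR (S p)).
      intros Hd.
      assert (Hbx : 0 < b * x) by (apply Rmult_lt_0_compat; lra).
      assert ((N + 1) * (1 - b) / 2 - b <= 0).
      { apply (Rmult_le_reg_l (b * x)); [exact Hbx|]. lra. }
      nra.
    (* If row [p + 1] were positive at [k], induction would make row [p + 2] positive there, and the
       recurrence would contradict [Hd]. *)
    - destruct (Rle_lt_dec (stepdiff b (S p) k) 0) as [L|L]; [exact L|exfalso].
      assert (Hk : (S (S (S p)) <= k)%nat) by lia.
      destruct (Rle_lt_dec (stepdiff b (S (S p)) k) 0) as [M|M].
      + pose proof (IH (S p) Hk M). lra.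
      + pose proof (stepdiff_rec b (S p) k) as Hr.
        assert (0 < INR (S k)) by (apply lt_0_INR; lia).
        assert (0 < INR (S (S p))) by (apply lt_0_INR; lia).
        assert (INR (S (S (S p))) <= INR k) by (apply le_INR; lia).
        pose proof (pos_INR (S (S (S p)))).
        assert (0 <= INR k - INR (S (S (S p))) * b) by nra.
        assert (0 < INR (S (S p)) * b * stepdiff b (S p) k)
          by (repeat apply Rmult_lt_0_compat; lra).
        nra. }
  (* Rows [p + 1] and [p] are now both nonpositive at [k], hence row [p + 1] is at [k + 1]. *)
  pose proof (IH p ltac:(lia) Key) as Key2.
  pose proof (stepdiff_rec b p k) as Hr.
  assert (0 < INR (S k)) by (apply lt_0_INR; lia).
  assert (0 < INR (S p)) by (apply lt_0_INR; lia).
  assert (INR (S (S p)) <= INR k) by (apply le_INR; lia).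
  pose proof (pos_INR (S (S p))).
  assert (0 <= INR k - INR (S (S p)) * b) by nra.
  assert (0 < INR (S p) * b) by (apply Rmult_lt_0_compat; lra).
  nra.
Qed.

(** If row [n] is nonpositive at [j], unimodality makes row [n - 1] nonpositive at [j], and the
    recurrence moves row [n] on to [j + 1]. *)
Lemma stepdiff_stays_nonpos (b : R) (n k j : nat) : 0 < b < 1 ->
  stepdiff b n k < 0 -> (k <= j)%nat -> stepdiff b n j <= 0.
Proof.
  intros Hb Hd.
  (* For [k <= n] the power [n + 1] vanishes at [k], so the difference is nonnegative there. *)
  assert (Hk : (S n <= k)%nat).
  { destruct (Nat.le_gt_cases (S n) k) as [H|H]; [exact H|exfalso].
    revert Hd. unfold stepdiff. rewrite (cpow_lt _ (S n) k) by (reflexivity || lia).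
    pose proof (cpow_nonneg (Aalpha b) n (fun k => Aalpha_nonneg b k ltac:(lra)) k). lra. }
  intros Hj. induction Hj as [|j Hj IH]; [lra|].
  destruct n as [|p]; [now apply stepdiff_0_neg|].
  assert (Key2 : stepdiff b p j <= 0) by (apply stepdiff_unimodal; auto; lia).
  pose proof (stepdiff_rec b p j) as Hr.
  assert (0 < INR (S j)) by (apply lt_0_INR; lia).
  assert (0 < INR (S p)) by (apply lt_0_INR; lia).
  assert (INR (S (S p)) <= INR j) by (apply le_INR; lia).
  pose proof (pos_INR (S (S p))).
  assert (0 <= INR j - INR (S (S p)) * b) by nra.
  assert (0 < INR (S p) * b) by (apply Rmult_lt_0_compat; lra).
  nra.
Qed.

(** Before the first negative term the two sums agree. From then on [Rabs (d k) = - d k], so their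
    total is frozen at twice a partial sum of [d]. *)
Lemma sum_Rabs_one_sign_change (d : nat -> R) (M : R) :
  (forall k j, d k < 0 -> (k <= j)%nat -> d j <= 0) ->
  (forall K, 0 <= sum_f_R0 d K <= M) ->
  forall K, sum_f_R0 (fun k => Rabs (d k)) K <= 2 * M.
Proof.
  intros Hs HM K.
  assert (H : sum_f_R0 (fun k => Rabs (d k)) K = sum_f_R0 d K \/
    ((exists k, (k <= K)%nat /\ d k < 0) /\
     sum_f_R0 (fun k => Rabs (d k)) K + sum_f_R0 d K <= 2 * M)).
  { induction K as [|K IH].
    - left. simpl. apply Rabs_pos_eq. apply (HM O).
    - rewrite !tech5.
      destruct IH as [IH|[[k [Hk Hd]] IH]].
      + destruct (Rlt_le_dec (d (S K)) 0) as [L|L].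
        * right. split; [exists (S K); split; [lia | exact L]|].
          rewrite IH, Rabs_left by exact L. pose proof (HM K). lra.
        * left. rewrite IH, Rabs_pos_eq by exact L. reflexivity.
      + right. split; [exists k; split; [lia | exact Hd]|].
        rewrite Rabs_left1 by (apply (Hs k); [exact Hd | lia]). lra. }
  pose proof (HM K). destruct H as [H|[_ H]]; lra.
Qed.

Lemma sum_Rabs_stepdiff (b : R) (n K : nat) : 0 < b < 1 ->
  sum_f_R0 (fun k => Rabs (stepdiff b n k)) K <= 2 * (/ (INR (S n) * (b * (1 - b)))).
Proof.
  intros Hb. apply sum_Rabs_one_sign_change.
  - intros k j Hk Hj. now apply (stepdiff_stays_nonpos b n k).
  - intros J. pose proof (sum_stepdiff b n J) as E.
    assert (Hn : 0 < INR (S n)) by (apply lt_0_INR; lia).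
    assert (Hnb : 0 < INR (S n) * b) by (apply Rmult_lt_0_compat; lra).
    assert (0 <= INR (S J) * cpow (Aalpha b) (S n) (S J)).
    { apply Rmult_le_pos; [apply pos_INR|].
      apply cpow_nonneg; intros; apply Aalpha_nonneg; lra. }
    pose proof (cpow_Aalpha_bound b (S n) (S J) Hb) as B.
    split.
    + nra.
    + apply (Rmult_le_reg_l (INR (S n) * b)); [exact Hnb|].
      rewrite E. replace (INR (S n) * b * / (INR (S n) * (b * (1 - b)))) with (/ (1 - b))
        by (field; lra). exact B.
Qed.

(** * Subordination *)

(** The generating function is the composition of that of [X] with that of [B]. [Bbeta eps b] is
    convertible to [subord (Beps eps) (Aalpha b)]. *)
Definition subord (B X : nat -> R) (j : nat) : R := Series (fun k => X k * cpow B k j).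

Lemma Series_finite (a : nat -> R) (N : nat) :
  (forall i, (N < i)%nat -> a i = 0) -> Series a = sum_f_R0 a N.
Proof.
  intros H. apply is_series_unique, is_series_Reals.
  intros e He. exists N. intros n Hn.
  rewrite (sum_f_R0_extend a N n) by (lia || assumption). rewrite R_dist_eq. exact He.
Qed.

(** As [B O = 0], the power [k] starts at index [k]. Any cutoff [N >= j] is allowed so that several
    sums can share one range. *)
Lemma subord_sum (B X : nat -> R) (j N : nat) : B O = 0 -> (j <= N)%nat ->
  subord B X j = sum_f_R0 (fun k => X k * cpow B k j) N.
Proof.
  intros HB HN. apply Series_finite. intros i Hi. rewrite cpow_lt by (assumption || lia). ring.
Qed.

Lemma subord_delta0 (B : nat -> R) : B O = 0 -> subord B delta0 = delta0.
Proof.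
  intros HB. apply functional_extensionality; intros j.
  rewrite (subord_sum B _ j j HB) by lia.
  rewrite (sum_f_R0_extend _ 0 j); [simpl; ring | lia |].
  intros [|i] Hi; [lia|]; simpl; ring.
Qed.

(** Composition respects products: both sides equal the sum of [G k l] over the square [k, l <= j],
    where terms with [k + l > j] vanish. *)
Lemma subord_conv (B X Y : nat -> R) : B O = 0 ->
  subord B (conv X Y) = conv (subord B X) (subord B Y).
Proof.
  intros HB. apply functional_extensionality; intros j.
  set (G := fun k l => X k * Y l * cpow B (k + l) j).
  transitivity (sum_f_R0 (fun k => sum_f_R0 (G k) j) j).
  - rewrite (subord_sum B _ j j HB) by lia.
    rewrite (sum_eq _ (fun m => sum_f_R0 (fun i => G i (m - i)%nat) m) j).
    + rewrite sum_f_R0_triangle_swap. apply sum_eq; intros i Hi.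
      symmetry; apply sum_f_R0_extend; [lia|].
      intros l Hl. unfold G. rewrite cpow_lt by (assumption || lia). ring.
    + intros m Hm. unfold conv. rewrite Rmult_comm, scal_sum.
      apply sum_eq; intros i Hi. unfold G.
      replace (i + (m - i))%nat with m by lia. reflexivity.
  - symmetry. unfold conv at 1.
    rewrite (sum_eq _ (fun i => sum_f_R0 (fun k => sum_f_R0 (fun l =>
       X k * Y l * (cpow B k i * cpow B l (j - i)%nat)) j) j) j).
    + rewrite (sum_f_R0_swap (fun i k => sum_f_R0 (fun l =>
        X k * Y l * (cpow B k i * cpow B l (j - i)%nat)) j)).
      apply sum_eq; intros k Hk.
      rewrite (sum_f_R0_swap (fun i l => X k * Y l * (cpow B k i * cpow B l (j - i)%nat))).
      apply sum_eq; intros l Hl. unfold G. rewrite cpow_add. unfold conv.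
      rewrite scal_sum. apply sum_eq; intros i Hi. ring.
    + intros i Hi. rewrite (subord_sum B X i j HB) by lia.
      rewrite (subord_sum B Y (j - i) j HB) by lia.
      rewrite Rmult_comm, scal_sum. apply sum_eq; intros k Hk.
      rewrite scal_sum. apply sum_eq; intros l Hl. ring.
Qed.

Lemma cpow_subord (B X : nat -> R) (n : nat) : B O = 0 ->
  cpow (subord B X) n = subord B (cpow X n).
Proof.
  intros HB. induction n as [|n IH]; simpl.
  - now rewrite subord_delta0.
  - now rewrite IH, subord_conv.
Qed.

Lemma sum_subord (B X : nat -> R) (J : nat) : B O = 0 ->
  sum_f_R0 (subord B X) J = sum_f_R0 (fun k => X k * sum_f_R0 (cpow B k) J) J.
Proof.
  intros HB.
  rewrite (sum_eq (subord B X) (fun j => sum_f_R0 (fun k => X k * cpow B k j) J) J)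
    by (intros; now apply subord_sum).
  rewrite (sum_f_R0_swap (fun j k => X k * cpow B k j)).
  apply sum_eq; intros k Hk. rewrite scal_sum. apply sum_eq; intros; ring.
Qed.

(** Triangle inequality, exchange of sums, and total mass 1 of each [cpow B k]. *)
Lemma sum_Rabs_subord_le (B X : nat -> R) (J : nat) :
  B O = 0 -> (forall k, 0 <= B k) -> is_series B 1 ->
  sum_f_R0 (fun j => Rabs (subord B X j)) J <= sum_f_R0 (fun k => Rabs (X k)) J.
Proof.
  intros HB Bpos SB.
  apply Rle_trans with (sum_f_R0 (subord B (fun k => Rabs (X k))) J).
  - apply sum_Rle; intros j Hj. rewrite !(subord_sum B _ j J HB) by exact Hj.
    eapply Rle_trans; [apply Rsum_abs|].
    right; apply sum_eq; intros k Hk.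
    rewrite Rabs_mult, (Rabs_pos_eq (cpow B k j)) by now apply cpow_nonneg. reflexivity.
  - rewrite sum_subord by exact HB. apply sum_Rle; intros k Hk.
    rewrite <- (Rmult_1_r (Rabs (X k))) at 2.
    apply Rmult_le_compat_l; [apply Rabs_pos|].
    apply nonneg_series_partial; [now apply cpow_nonneg | now apply cpow_prob].
Qed.

Lemma subord_nonneg (B X : nat -> R) : B O = 0 -> (forall k, 0 <= B k) ->
  (forall k, 0 <= X k) -> forall j, 0 <= subord B X j.
Proof.
  intros HB Bpos Xpos j. rewrite (subord_sum B X j j HB) by lia.
  apply cond_pos_sum; intros k. apply Rmult_le_pos; [apply Xpos | now apply cpow_nonneg].
Qed.

Lemma is_lim_seq_sum_f_R0 (a : nat -> nat -> R) (l : nat -> R) (N : nat) :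
  (forall k, is_lim_seq (a k) (l k)) ->
  is_lim_seq (fun J => sum_f_R0 (fun k => a k J) N) (sum_f_R0 l N).
Proof.
  intros H. induction N as [|N IH]; simpl; [apply H|].
  apply is_lim_seq_plus'; [exact IH | apply H].
Qed.

(** The contraction bounds the mass by 1. Conversely, only [k <= N] is kept; letting the range [J]
    of the powers grow gives mass at least [sum_f_R0 X N], and then [N] grows. *)
Lemma subord_prob (B X : nat -> R) :
  B O = 0 -> (forall k, 0 <= B k) -> is_series B 1 ->
  (forall k, 0 <= X k) -> is_series X 1 -> is_series (subord B X) 1.
Proof.
  intros HB Bpos SB Xpos SX.
  assert (Spos := subord_nonneg B X HB Bpos Xpos).
  assert (Hle : forall J, sum_f_R0 (subord B X) J <= 1).
  { intros J. rewrite (sum_eq _ (fun j => Rabs (subord B X j)))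
      by (intros; now rewrite Rabs_pos_eq).
    eapply Rle_trans; [now apply sum_Rabs_subord_le|].
    rewrite (sum_eq _ X) by (intros; now rewrite Rabs_pos_eq).
    now apply nonneg_series_partial. }
  destruct (nonneg_bounded_series _ 1 Spos Hle) as [Hex Hle1].
  replace 1 with (Series (subord B X)); [now apply Series_correct|].
  apply Rle_antisym; [exact Hle1|].
  apply (is_lim_seq_le (sum_n X) (fun _ => Series (subord B X)) 1 (Series (subord B X)));
    [| exact SX | apply is_lim_seq_const].
  intros N. rewrite sum_n_Reals.
  apply (is_lim_seq_le_loc (fun J => sum_f_R0 (fun k => X k * sum_n (cpow B k) J) N)
           (fun _ => Series (subord B X)) (sum_f_R0 X N) (Series (subord B X)));
    [| | apply is_lim_seq_const].
  - exists N. intros J HJ.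
    apply Rle_trans with (sum_f_R0 (subord B X) J).
    + rewrite sum_subord by exact HB.
      rewrite (sum_eq (fun k => X k * sum_n (cpow B k) J)
                 (fun k => X k * sum_f_R0 (cpow B k) J) N)
        by (intros; now rewrite sum_n_Reals).
      apply sum_f_R0_incr; [|exact HJ]. intros k.
      apply Rmult_le_pos; [apply Xpos | apply cond_pos_sum; now apply cpow_nonneg].
    + apply nonneg_series_partial; [exact Spos | now apply Series_correct].
  - apply is_lim_seq_sum_f_R0. intros k.
    replace (Finite (X k)) with (Rbar_mult (X k) 1) by (simpl; f_equal; ring).
    apply is_lim_seq_scal_l. exact (cpow_prob B k Bpos SB).
Qed.

Lemma prob_isProb (F : nat -> R) : (forall k, 0 <= F k) -> is_series F 1 -> isProb F.
Proof.
  intros Fpos SF. split; [|exact SF]. intros k. split; [apply Fpos|].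
  apply Rle_trans with (sum_f_R0 F k); [|now apply nonneg_series_partial].
  destruct k as [|k]; simpl; [lra|].
  pose proof (cond_pos_sum F k Fpos). lra.
Qed.

Lemma subord_Aalpha_inA (B : nat -> R) (b : R) : 0 < b < 1 ->
  B O = 0 -> (forall k, 0 <= B k) -> is_series B 1 -> inA (subord B (Aalpha b)).
Proof.
  intros Hb HB Bpos SB.
  assert (Apos : forall k, 0 <= Aalpha b k) by (intros; apply Aalpha_nonneg; lra).
  split.
  - apply prob_isProb; [now apply subord_nonneg|].
    apply subord_prob; auto. now apply Aalpha_prob.
  (* The bound of [sum_Rabs_stepdiff] times [n], with [n / (n + 1) <= 1]. *)
  - exists (2 * / (b * (1 - b))). intros n Hn.
    assert (E : forall k, Rabs (cpow (subord B (Aalpha b)) n k - cpow (subord B (Aalpha b)) (S n) k)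
                = Rabs (subord B (stepdiff b n) k)).
    { intros k. f_equal. rewrite !cpow_subord by exact HB.
      rewrite !(subord_sum B _ k k HB) by lia. rewrite <- minus_sum.
      apply sum_eq; intros i Hi. unfold stepdiff. ring. }
    assert (P1 : 0 < b * (1 - b)) by (apply Rmult_lt_0_compat; lra).
    assert (P2 : 0 < INR (S n)) by (apply lt_0_INR; lia).
    destruct (nonneg_bounded_series
      (fun k => Rabs (cpow (subord B (Aalpha b)) n k - cpow (subord B (Aalpha b)) (S n) k))
      (2 * / (INR (S n) * (b * (1 - b))))) as [H1 H2].
    + intros; apply Rabs_pos.
    + intros J. rewrite (sum_eq _ _ J (fun k _ => E k)).
      eapply Rle_trans; [now apply sum_Rabs_subord_le|].
      now apply sum_Rabs_stepdiff.
    + split; [exact H1|].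
      apply Rle_trans with (INR n * (2 * / (INR (S n) * (b * (1 - b))))).
      { apply Rmult_le_compat_l; [apply pos_INR | exact H2]. }
      replace (INR n * (2 * / (INR (S n) * (b * (1 - b)))))
        with ((INR n / INR (S n)) * (2 * / (b * (1 - b)))) by (field; lra).
      rewrite <- (Rmult_1_l (2 * / (b * (1 - b)))) at 2.
      apply Rmult_le_compat_r.
      { pose proof (Rinv_0_lt_compat _ P1). lra. }
      apply Rle_div_l; [exact P2|]. rewrite S_INR. lra.
Qed.

(** * The averaged law *)

Lemma continuous_sibuya_tail (k : nat) (a : R) : continuous (fun a => sibuya_tail a k) a.
Proof.
  induction k as [|k IH].
  - apply continuous_const.
  - apply (continuous_ext (fun a : R => mult (sibuya_tail a k) (1 - a / INR (S k)))).
    + intros x. symmetry. apply sibuya_tail_S.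
    + apply (continuous_mult (K := R_AbsRing)); [exact IH|].
      apply (continuous_minus (V := R_NormedModule)); [apply continuous_const|].
      apply (continuous_mult (K := R_AbsRing)); [apply continuous_id | apply continuous_const].
Qed.

Lemma ex_RInt_Aalpha (k : nat) (x y : R) : ex_RInt (fun a => Aalpha a k) x y.
Proof.
  apply (ex_RInt_continuous (V := R_CompleteNormedModule)). intros a _.
  destruct k as [|k]; [apply continuous_const|].
  apply (continuous_ext (fun a : R => a * sibuya_tail a k * / INR (S k))).
  - intros z. symmetry. apply Aalpha_S.
  - apply (continuous_mult (K := R_AbsRing)); [|apply continuous_const].
    apply (continuous_mult (K := R_AbsRing)); [apply continuous_id | apply continuous_sibuya_tail].
Qed.

Lemma ex_RInt_sibuya_tail (k : nat) (x y : R) : ex_RInt (fun a => sibuya_tail a k) x y.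
Proof.
  apply (ex_RInt_continuous (V := R_CompleteNormedModule)). intros a _. apply continuous_sibuya_tail.
Qed.

Lemma Beps_0 (eps : R) : Beps eps O = 0.
Proof. unfold Beps. simpl. rewrite RInt_const. unfold scal; simpl; unfold mult; simpl. ring. Qed.

Lemma Beps_nonneg (eps : R) (k : nat) : 0 < eps <= 1 -> 0 <= Beps eps k.
Proof.
  intros He. apply Rmult_le_pos; [left; apply Rinv_0_lt_compat; lra|].
  apply RInt_ge_0; [lra | apply ex_RInt_Aalpha |].
  intros x Hx. apply Aalpha_nonneg; lra.
Qed.

Lemma sum_Beps (eps : R) (N : nat) : 0 < eps ->
  sum_f_R0 (Beps eps) N = 1 - / eps * RInt (fun a => sibuya_tail a N) 0 eps.
Proof.
  intros He.
  assert (H : is_RInt (fun a => sum_f_R0 (Aalpha a) N) 0 eps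
                (sum_f_R0 (fun k => RInt (fun a => Aalpha a k) 0 eps) N)).
  { induction N as [|N IH]; simpl.
    - apply (RInt_correct (V := R_CompleteNormedModule)), (ex_RInt_Aalpha 0).
    - apply (is_RInt_plus (V := R_NormedModule)); [exact IH|].
      apply (RInt_correct (V := R_CompleteNormedModule)), (ex_RInt_Aalpha (S N)). }
  assert (H' : is_RInt (fun a => sum_f_R0 (Aalpha a) N) 0 eps
                 (eps - RInt (fun a => sibuya_tail a N) 0 eps)).
  { apply (is_RInt_ext (fun a => 1 - sibuya_tail a N)).
    - intros; symmetry; apply sum_Aalpha.
    - apply (is_RInt_minus (V := R_NormedModule)).
      + replace eps with (scal (eps - 0) 1) at 2
          by (unfold scal; simpl; unfold mult; simpl; ring).
        apply (is_RInt_const (V := R_NormedModule)).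
      + apply (RInt_correct (V := R_CompleteNormedModule)), ex_RInt_sibuya_tail. }
  assert (E : sum_f_R0 (fun k => RInt (fun a => Aalpha a k) 0 eps) N =
              eps - RInt (fun a => sibuya_tail a N) 0 eps).
  { rewrite <- (is_RInt_unique _ _ _ _ H). apply is_RInt_unique, H'. }
  replace (sum_f_R0 (Beps eps) N)
    with (/ eps * sum_f_R0 (fun k => RInt (fun a => Aalpha a k) 0 eps) N).
  - rewrite E. field. lra.
  - rewrite scal_sum. apply sum_eq; intros; unfold Beps; ring.
Qed.

(** Integrating [(N+1)^(-a) = exp (- a L)] gives [(1 - exp (- eps L)) / L]; [1 <= N] ensures
    [L > 0]. *)
Lemma RInt_sibuya_tail_bounds (eps : R) (N : nat) : 0 < eps <= 1 -> (1 <= N)%nat ->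
  0 <= RInt (fun a => sibuya_tail a N) 0 eps <= / ln (INR (S N)).
Proof.
  intros He HN. split.
  - apply RInt_ge_0; [lra | apply ex_RInt_sibuya_tail |].
    intros x Hx. apply sibuya_tail_nonneg; lra.
  - set (L := ln (INR (S N))).
    assert (HL : 0 < L).
    { unfold L. rewrite <- ln_1. apply ln_increasing; [lra|].
      apply (lt_INR 1); lia. }
    assert (HI : is_RInt (fun a => exp (- (a * L))) 0 eps
                   (minus (- exp (- (eps * L)) / L) (- exp (- (0 * L)) / L))).
    { apply (is_RInt_derive (V := R_CompleteNormedModule) (fun a => - exp (- (a * L)) / L)).
      - intros x _. auto_derive; [exact I | field; lra].
      - intros x _. apply (ex_derive_continuous (V := R_NormedModule)). auto_derive. exact I. }
    apply Rle_trans with (RInt (fun a => exp (- (a * L))) 0 eps).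
    + apply RInt_le; [lra | apply ex_RInt_sibuya_tail | eexists; exact HI |].
      intros x Hx. apply sibuya_tail_le; lra.
    + rewrite (is_RInt_unique _ _ _ _ HI).
      rewrite Rmult_0_l, Ropp_0, exp_0.
      unfold minus, plus, opp; simpl.
      pose proof (exp_pos (- (eps * L))). pose proof (Rinv_0_lt_compat _ HL).
      unfold Rdiv. nra.
Qed.

Lemma Beps_prob (eps : R) : 0 < eps <= 1 -> is_series (Beps eps) 1.
Proof.
  intros He.
  apply is_series_sandwich with (b := fun N => / eps * RInt (fun a => sibuya_tail a N) 0 eps).
  - intros N. rewrite sum_Beps by lra.
    assert (0 <= / eps * RInt (fun a => sibuya_tail a N) 0 eps).
    { apply Rmult_le_pos; [left; apply Rinv_0_lt_compat; lra|].
      apply RInt_ge_0; [lra | apply ex_RInt_sibuya_tail |].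
      intros x Hx. apply sibuya_tail_nonneg; lra. }
    lra.
  - replace (Finite 0) with (Rbar_mult (/ eps) 0) by (simpl; f_equal; ring).
    apply is_lim_seq_scal_l.
    apply is_lim_seq_le_le_loc with (u := fun _ => 0) (w := fun N => / ln (INR (S N))).
    + exists 1%nat. intros N HN. now apply RInt_sibuya_tail_bounds.
    + apply is_lim_seq_const.
    + replace (Finite 0) with (Rbar_inv p_infty) by reflexivity.
      apply is_lim_seq_inv; [apply lim_ln_S | discriminate].
Qed.

(** * Lower bound for the Fourier transform near the origin *)

Lemma Aalpha_ge (a : R) (m : nat) : 0 <= a <= 1 ->
  a * (1 - a) * (exp (- (a * ln (INR (S m)))) / INR (S m)) <= Aalpha a (S m).
Proof.
  intros Ha. rewrite Aalpha_S.
  assert (HS : 0 < INR (S m)) by (apply lt_0_INR; lia).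
  assert (HQ : (1 - a) * exp (- (a * ln (INR (S m)))) <= sibuya_tail a m).
  { destruct m as [|p].
    - unfold sibuya_tail; simpl. rewrite ln_1, Rmult_0_r, Ropp_0, exp_0. lra.
    - eapply Rle_trans; [|now apply sibuya_tail_ge].
      apply Rmult_le_compat_l; [lra|]. apply exp_monotone, Ropp_le_contravar.
      apply Rmult_le_compat_l; [lra|].
      apply ln_le; [apply lt_0_INR; lia | apply le_INR; lia]. }
  replace (a * (1 - a) * (exp (- (a * ln (INR (S m)))) / INR (S m)))
    with (a * ((1 - a) * exp (- (a * ln (INR (S m))))) / INR (S m)) by (field; lra).
  apply Rmult_le_compat_r; [left; now apply Rinv_0_lt_compat|].
  apply Rmult_le_compat_l; lra.
Qed.

(** Only [a] in [[d/2, d]] is kept: an interval of length [d/2], on which [a (1 - a) >= d/4] and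
    [(m+1)^(-a) >= (m+1)^(-d)]. *)
Lemma Beps_ge (eps d : R) (m : nat) : 0 < d <= 1 / 2 -> d <= eps <= 1 ->
  / eps * (d / 2) * (d / 4) * (exp (- (d * ln (INR (S m)))) / INR (S m)) <= Beps eps (S m).
Proof.
  intros Hd He. unfold Beps.
  set (w := exp (- (d * ln (INR (S m)))) / INR (S m)).
  replace (/ eps * (d / 2) * (d / 4) * w) with (/ eps * ((d - d / 2) * (d / 4 * w)))
    by (field; lra).
  apply Rmult_le_compat_l; [left; apply Rinv_0_lt_compat; lra|].
  assert (HS : 1 <= INR (S m)) by (rewrite S_INR; pose proof (pos_INR m); lra).
  assert (Hpos : forall x y, 0 <= x -> x <= y -> y <= 1 -> 0 <= RInt (fun a => Aalpha a (S m)) x y).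
  { intros x y H0 H1 H2. apply RInt_ge_0; [exact H1 | apply ex_RInt_Aalpha |].
    intros z Hz. apply Aalpha_nonneg; lra. }
  rewrite <- (RInt_Chasles (V := R_CompleteNormedModule) _ 0 (d / 2) eps) by apply ex_RInt_Aalpha.
  rewrite <- (RInt_Chasles (V := R_CompleteNormedModule) _ (d / 2) d eps) by apply ex_RInt_Aalpha.
  unfold plus; simpl plus.
  pose proof (Hpos 0 (d / 2) ltac:(lra) ltac:(lra) ltac:(lra)) as P1.
  pose proof (Hpos d eps ltac:(lra) ltac:(lra) ltac:(lra)) as P2.
  assert (P3 : (d - d / 2) * (d / 4 * w) <= RInt (fun a => Aalpha a (S m)) (d / 2) d).
  { replace ((d - d / 2) * (d / 4 * w)) with (RInt (fun _ => d / 4 * w) (d / 2) d)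
      by (rewrite RInt_const; reflexivity).
    apply RInt_le; [lra | apply ex_RInt_const | apply ex_RInt_Aalpha |].
    intros a Ha. eapply Rle_trans; [|apply Aalpha_ge; lra].
    apply Rmult_le_compat; [lra | | nra |].
    - apply Rmult_le_pos; [left; apply exp_pos | left; apply Rinv_0_lt_compat; lra].
    - apply Rmult_le_compat_r; [left; apply Rinv_0_lt_compat; lra|].
      apply exp_monotone, Ropp_le_contravar, Rmult_le_compat_r; [|lra].
      rewrite <- ln_1. apply ln_le; lra. }
  simpl in *. lra.
Qed.

Lemma Bbeta_ge (eps b : R) (j : nat) : 0 < eps <= 1 -> 0 < b < 1 ->
  b * Beps eps j <= Bbeta eps b j.
Proof.
  intros He Hb.
  assert (Bpos : forall k, 0 <= Beps eps k) by (intros; now apply Beps_nonneg).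
  change (Bbeta eps b j) with (subord (Beps eps) (Aalpha b) j).
  (* The cutoff [1 + j] reaches index 1 even for [j = 0]; the term [k = 1] is [b * Beps eps j]. *)
  rewrite (subord_sum _ _ j (1 + j)) by (apply Beps_0 || lia).
  apply Rle_trans with (sum_f_R0 (fun k => Aalpha b k * cpow (Beps eps) k j) 1).
  - rewrite tech5, cpow_1. right. simpl. field.
  - apply sum_f_R0_incr; [|lia]. intros k.
    apply Rmult_le_pos; [apply Aalpha_nonneg; lra | now apply cpow_nonneg].
Qed.

(** The left side is a partial sum, with nonnegative terms, of the real part of
    [1 - fourier F xi]. *)
Lemma sum_cos_le_Cmod (F : nat -> R) (xi : R) (N : nat) :
  (forall k, 0 <= F k) -> is_series F 1 ->
  sum_f_R0 (fun k => F k * (1 - cos (INR k * xi))) N <= Cmod (RtoC 1 - fourier F xi).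
Proof.
  intros Fpos SF.
  assert (Hex : ex_series (fun k => F k * cos (INR k * xi))).
  { apply (ex_series_le (V := R_CompleteNormedModule) _ F); [|now exists 1].
    intros k. unfold norm; simpl; unfold abs; simpl.
    rewrite Rabs_mult, (Rabs_pos_eq (F k)) by apply Fpos.
    rewrite <- (Rmult_1_r (F k)) at 2. apply Rmult_le_compat_l; [apply Fpos|].
    apply Rabs_le, COS_bound. }
  apply Rle_trans with (1 - Series (fun k => F k * cos (INR k * xi))).
  - apply nonneg_series_partial.
    + intros k. apply Rmult_le_pos; [apply Fpos|].
      pose proof (COS_bound (INR k * xi)). lra.
    + apply (is_series_ext (fun k => F k - F k * cos (INR k * xi))).
      * intros k. change (F k - F k * cos (INR k * xi) = F k * (1 - cos (INR k * xi)) :> R). ring.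
      * apply (is_series_minus (V := R_NormedModule)); [exact SF | now apply Series_correct].
  - eapply Rle_trans; [apply Rle_abs|].
    eapply Rle_trans; [|apply Rmax_Cmod].
    eapply Rle_trans; [|apply Rmax_l]. simpl. right. f_equal.
Qed.

Lemma sum_window_ge (g : nat -> R) (m : R) (N p : nat) :
  (forall k, 0 <= g k) -> (forall k, (N < k <= N + p)%nat -> m <= g k) ->
  INR p * m <= sum_f_R0 g (N + p).
Proof.
  intros Hg Hm. induction p as [|p IH].
  - simpl. rewrite Rmult_0_l. now apply cond_pos_sum.
  - rewrite Nat.add_succ_r, tech5, S_INR.
    pose proof (Hm (S (N + p)) ltac:(lia)).
    pose proof (IH ltac:(intros; apply Hm; lia)). lra.
Qed.

(* The terms with [N < k <= 2N], [N ~ 1/|xi|], suffice: there [k |xi|] lies in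
   [1/2, 2] and [1 - cos (k xi)] is bounded below. *)
Lemma one_minus_fourier_ge (F : nat -> R) (c d xi : R) :
  0 <= c -> 0 <= d -> (forall k, 0 <= F k) -> is_series F 1 ->
  (forall m, c * (exp (- (d * ln (INR (S m)))) / INR (S m)) <= F (S m)) ->
  0 < Rabs xi <= 1 ->
  c * (1 - cos (1 / 2)) / 2 * exp (- (d * ln 2)) * Rpower (Rabs xi) d
    <= Cmod (RtoC 1 - fourier F xi).
Proof.
  intros Hc Hd Fpos SF HF Hxi.
  assert (Hinv : 1 <= / Rabs xi) by (rewrite <- Rinv_1; apply Rinv_le_contravar; lra).
  (* [N] is the floor of [1/|xi|]; since [N >= 1], [N + 1 <= 2 N] gives [N |xi| >= 1/2]. *)
  destruct (nfloor_ex (/ Rabs xi) ltac:(lra)) as [N [HN1 HN2]].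
  assert (HN : 1 <= INR N).
  { destruct N as [|N]; [simpl in HN2; lra|]. rewrite S_INR. pose proof (pos_INR N); lra. }
  assert (Ix : / Rabs xi * Rabs xi = 1) by (field; lra).
  assert (Up : INR N * Rabs xi <= 1) by nra.
  assert (Lo : 1 / 2 <= INR N * Rabs xi) by nra.
  eapply Rle_trans; [|apply (sum_cos_le_Cmod F xi (N + N) Fpos SF)].
  assert (Cpos : cos (1 / 2) <= 1) by apply COS_bound.
  set (E := exp (- (d * ln (2 * INR N)))).
  assert (Epos : 0 < E) by apply exp_pos.
  apply Rle_trans with (INR N * (c * (E / (2 * INR N)) * (1 - cos (1 / 2)))).
  - replace (INR N * (c * (E / (2 * INR N)) * (1 - cos (1 / 2))))
      with (c * (1 - cos (1 / 2)) / 2 * E) by (field; lra).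
    rewrite Rmult_assoc. apply Rmult_le_compat_l.
    { apply Rmult_le_pos; [apply Rmult_le_pos; lra | lra]. }
    unfold E, Rpower. rewrite <- exp_plus. apply exp_monotone.
    (* From [N <= 1/|xi|], so that [E = (2N)^(-d)] is at least [2^(-d) |xi|^d]. *)
    assert (ln (2 * INR N) <= ln 2 - ln (Rabs xi)).
    { rewrite <- ln_div by lra. apply ln_le; [lra|].
      unfold Rdiv. apply Rmult_le_compat_l; lra. }
    nra.
  - apply sum_window_ge.
    + intros k. apply Rmult_le_pos; [apply Fpos|]. pose proof (COS_bound (INR k * xi)). lra.
    + intros k Hk. destruct k as [|k]; [lia|].
      assert (K1 : INR N <= INR (S k)) by (apply le_INR; lia).
      assert (K2 : INR (S k) <= 2 * INR N).
      { apply Rle_trans with (INR (N + N)); [apply le_INR; lia | rewrite plus_INR; lra]. }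
      apply Rmult_le_compat.
      * apply Rmult_le_pos; [exact Hc | apply Rmult_le_pos; [lra | left; apply Rinv_0_lt_compat; lra]].
      * lra.
      * eapply Rle_trans; [|apply HF]. apply Rmult_le_compat_l; [exact Hc|].
        apply Rmult_le_compat; [lra | left; apply Rinv_0_lt_compat; lra | |].
        -- apply exp_monotone, Ropp_le_contravar, Rmult_le_compat_l; [exact Hd|].
           apply ln_le; lra.
        -- apply Rinv_le_contravar; lra.
      * apply Rplus_le_compat_l, Ropp_le_contravar.
        (* By evenness the argument lies in [[1/2, 2]], inside [[0, PI]] where [cos] decreases. *)
        replace (cos (INR (S k) * xi)) with (cos (INR (S k) * Rabs xi)).
        -- pose proof PI2_3_2. assert (INR (S k) * Rabs xi <= 2) by nra.
           assert (1 / 2 <= INR (S k) * Rabs xi) by nra.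
           apply cos_decr_1; lra.
        -- unfold Rabs. destruct (Rcase_abs xi); [|reflexivity].
           rewrite Ropp_mult_distr_r_reverse. apply cos_neg.
Qed.

(** The quotient is at most [|xi|^(a-d) / K], with positive exponent [a - d]. *)
Lemma is_lim_Rpower_div (G : R -> R) (K d a : R) : 0 < K -> d < a ->
  (forall xi, 0 < Rabs xi <= 1 -> K * Rpower (Rabs xi) d <= G xi) ->
  is_lim (fun xi => Rpower (Rabs xi) a / G xi) 0 0.
Proof.
  intros HK Had HG. apply is_lim_spec. intros eta.
  assert (Heta : 0 < eta * K) by (apply Rmult_lt_0_compat; [apply cond_pos | exact HK]).
  (* The radius solves [r^(a-d) = eta K], capped at 1 so that [HG] applies. *)
  assert (Hdel : 0 < Rmin 1 (Rpower (eta * K) (/ (a - d)))).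
  { apply Rmin_pos; [lra | apply exp_pos]. }
  exists (mkposreal _ Hdel). intros xi Hball Hne.
  change (Rabs (xi - 0) < Rmin 1 (Rpower (eta * K) (/ (a - d)))) in Hball.
  rewrite Rminus_0_r in Hball.
  assert (Hx : 0 < Rabs xi) by now apply Rabs_pos_lt.
  assert (H1 : Rabs xi < 1) by (eapply Rlt_le_trans; [exact Hball | apply Rmin_l]).
  assert (H2 : Rabs xi < Rpower (eta * K) (/ (a - d)))
    by (eapply Rlt_le_trans; [exact Hball | apply Rmin_r]).
  assert (H3 : Rpower (Rabs xi) (a - d) < eta * K).
  { rewrite <- (Rpower_1 (eta * K)) by exact Heta.
    replace 1 with (/ (a - d) * (a - d)) by (field; lra).
    rewrite <- Rpower_mult. apply Rlt_Rpower_l; lra. }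
  pose proof (HG xi ltac:(lra)) as HGx.
  assert (Pd : 0 < Rpower (Rabs xi) d) by apply exp_pos.
  assert (Pa : 0 < Rpower (Rabs xi) a) by apply exp_pos.
  assert (PG : 0 < G xi) by (eapply Rlt_le_trans; [|exact HGx]; now apply Rmult_lt_0_compat).
  rewrite Rminus_0_r, Rabs_pos_eq.
  - apply Rlt_div_l; [exact PG|].
    replace a with ((a - d) + d) by ring. rewrite Rpower_plus.
    apply Rlt_le_trans with (eta * K * Rpower (Rabs xi) d).
    + now apply Rmult_lt_compat_r.
    + rewrite Rmult_assoc. apply Rmult_le_compat_l; [left; apply cond_pos | exact HGx].
  - left. now apply Rdiv_lt_0_compat.
Qed.

Theorem theorem6p1 (eps beta : R) (Heps : 0 < eps <= 1) (Hbeta : 0 < beta < 1) :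
  inA (Bbeta eps beta) /\
  forall alpha : R, 0 < alpha < 1 ->
    is_lim (fun xi => Rpower (Rabs xi) alpha / Cmod (RtoC 1 - fourier (Bbeta eps beta) xi))
           0 0.
Proof.
  assert (HA : inA (Bbeta eps beta)).
  { apply (subord_Aalpha_inA (Beps eps) beta Hbeta).
    - apply Beps_0.
    - intros; now apply Beps_nonneg.
    - now apply Beps_prob. }
  split; [exact HA|].
  intros alpha Halpha.
  destruct HA as [[Fpos SF] _].
  (* [d <= eps] keeps the window inside the averaging interval; [d <= alpha / 2] gives both
     [d < alpha] and [d <= 1/2]. *)
  set (d := Rmin eps (alpha / 2)).
  assert (Hd1 : d <= eps) by apply Rmin_l.
  assert (Hd2 : d <= alpha / 2) by apply Rmin_r.
  assert (Hd0 : 0 < d) by (apply Rmin_pos; lra).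
  set (c := beta * (/ eps * (d / 2) * (d / 4))).
  assert (Hc : 0 < c).
  { unfold c. pose proof (Rinv_0_lt_compat eps ltac:(lra)).
    apply Rmult_lt_0_compat; [|apply Rmult_lt_0_compat; [apply Rmult_lt_0_compat|]]; lra. }
  (* Strictness makes the constant [K] below positive. *)
  assert (Hcos : cos (1 / 2) < 1).
  { rewrite <- cos_0 at 2. pose proof PI2_3_2. apply cos_decreasing_1; lra. }
  apply is_lim_Rpower_div
    with (K := c * (1 - cos (1 / 2)) / 2 * exp (- (d * ln 2))) (d := d).
  - apply Rmult_lt_0_compat; [|apply exp_pos].
    apply Rdiv_lt_0_compat; [apply Rmult_lt_0_compat|]; lra.
  - lra.
  - intros xi Hxi. apply one_minus_fourier_ge; try lra; try assumption.
    + intros k; apply Fpos.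
    + intros m. eapply Rle_trans; [|now apply Bbeta_ge].
      unfold c. rewrite Rmult_assoc. apply Rmult_le_compat_l; [lra|].
      apply Beps_ge; lra.
Qed.
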